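(* Let $\mathfrak{A}$ and $\mathfrak{A}'$ be two alternative $*$-algebras with identities $1_{\mathfrak{A}}$ and $1_{\mathfrak{A}'}$, respectively, and let $e_1$ and $e_2 = 1_{\mathfrak{A}} - e_1$ be nontrivial symmetric idempotents in $\mathfrak{A}$. Suppose that $\mathfrak{A}$ satisfies: for each $j \in \{1,2\}$ and each $x \in \mathfrak{A}$, $(e_j\mathfrak{A})x = \{0\}$ implies $x = 0$. Let $n \geq 2$ be an integer and let $\varphi : \mathfrak{A} \to \mathfrak{A}'$ be a bijective unital map which satisfies $$\varphi(p_{n_*}(a,b,\xi,\ldots,\xi)) = p_{n_*}(\varphi(a),\varphi(b),\varphi(\xi),\ldots,\varphi(\xi))$$ for all $a,b \in \mathfrak{A}$ and $\xi \in \{e_1,e_2,1_{\mathfrak{A}}\}$. Then $\varphi$ is $*$-additive, i.e. $\varphi(a+b)=\varphi(a)+\varphi(b)$ and $\varphi(a^* )=\varphi(a)^*$ for all $a,b\in\mathfrak{A}$.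
   Context: All algebras are over the field of complex numbers $\mathbb{C}$ and are not assumed associative or commutative. An algebra $\mathfrak{A}$ is alternative if $a^2b = a(ab)$ and $ba^2 = (ba)a$ for all $a,b\in\mathfrak{A}$. A $*$-algebra is an algebra endowed with an involution, i.e. a map $*:\mathfrak{A}\to\mathfrak{A}$ with $(x+y)^*=x^*+y^*$, $(x^* )^*=x$ and $(xy)^*=y^*x^*$ for all $x,y$. An element $s$ is symmetric if $s^*=s$. An idempotent $e_1$ is nontrivial if $e_1\neq 0$ and $e_1 \neq 1_{\mathfrak{A}}$. The notation $(e_j\mathfrak{A})x=\{0\}$ means $(e_ja)x=0$ for all $a\in\mathfrak{A}$. In a $*$-algebra put $[x_1,x_2]_*=x_1x_2-x_2x_1^*$, and define recursively $p_{1_*}(x)=x$ and $p_{n_*}(x_1,\ldots,x_n)=[p_{(n-1)_*}(x_1,\ldots,x_{n-1}),x_n]_*$ for $n\ge 2$. In $p_{n_*}(a,b,\xi,\ldots,\xi)$ the element $\xi$ occupies the last $n-2$ positions. A map $\varphi:\mathfrak{A}\to\mathfrak{A}'$ (not assumed additive) is unital if $\varphi(1_{\mathfrak{A}})=1_{\mathfrak{A}'}$. *)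

(* Defs.v *)
From HB Require Import structures.
From mathcomp Require Import all_boot all_order all_algebra.
From mathcomp Require Import reals complex.

Set Implicit Arguments.
Unset Strict Implicit.
Unset Printing Implicit Defensive.

Import GRing.Theory.
Local Open Scope ring_scope.

Reserved Notation "x ** y" (at level 40, left associativity).

(* Unital algebras whose product is only assumed bilinear: MathComp's own
   algebra structures are all associative. The case 1 = 0 is allowed. *)
HB.mixin Record isNonassocAlgebra (K : pzRingType) A of GRing.Lmodule K A := {
  namul : A -> A -> A;
  naone : A;
  namulDl : forall x y z : A, namul (x + y) z = namul x z + namul y z;
  namulDr : forall x y z : A, namul x (y + z) = namul x y + namul x z;
  nascaleAl : forall (k : K) (x y : A), k *: namul x y = namul (k *: x) y;
  nascaleAr : forall (k : K) (x y : A), k *: namul x y = namul x (k *: y);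
  namul1l : forall x : A, namul naone x = x;
  namul1r : forall x : A, namul x naone = x
}.

#[short(type="naAlgType")]
HB.structure Definition NonassocAlgebra (K : pzRingType) :=
  { A of GRing.Lmodule K A & isNonassocAlgebra K A }.

(* The involution is only required to be additive: it need be neither linear
   nor conjugate-linear. *)
HB.mixin Record hasInvolution (K : pzRingType) A of NonassocAlgebra K A := {
  star : A -> A;
  starD : forall x y : A, star (x + y) = star x + star y;
  starK : forall x : A, star (star x) = x;
  starM : forall x y : A, star (namul x y) = namul (star y) (star x)
}.

#[short(type="starAlgType")]
HB.structure Definition StarAlgebra (K : pzRingType) :=
  { A of NonassocAlgebra K A & hasInvolution K A }.

Notation "x ** y" := (namul x y) : ring_scope.

Definition alternative (K : pzRingType) (A : naAlgType K) : Prop :=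
  forall a b : A, (a ** a) ** b = a ** (a ** b) /\ b ** (a ** a) = (b ** a) ** a.

Definition idempotent_elt (K : pzRingType) (A : naAlgType K) (e : A) : Prop :=
  e ** e = e.

Definition nontrivial_elt (K : pzRingType) (A : naAlgType K) (e : A) : Prop :=
  e <> 0 /\ e <> naone.

Definition symmetric_elt (K : pzRingType) (A : starAlgType K) (s : A) : Prop :=
  star s = s.

Definition lie_star (K : pzRingType) (A : starAlgType K) (x1 x2 : A) : A :=
  x1 ** x2 - x2 ** star x1.

(* [pstar x1 [:: x2; ...; xn]] is p_{n*}(x1, ..., xn); the head is separated
   since n >= 1. *)
Definition pstar (K : pzRingType) (A : starAlgType K) (x1 : A) (s : seq A) : A :=
  foldl (@lie_star K A) x1 s.

(* Main.v *)
(* Put T_xi [x, y] = p_{n*}(x, y, xi, ..., xi); one may assume n >= 3, since the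
   hypothesis for n = 2 implies the one for n = 3. If phi c = phi a + phi b, then
   the same relation holds between the images of c, a, b under T_xi [x, -], so
   such a map kills d = c - (a + b) as soon as phi is additive at the images of
   a and b. The maps T_{e_i} [e_i, -] and T_{e_i} [x, -], x in A_{ji} (j <> i),
   detect the Peirce components of d, and all their values have the form
   u - u^* with u in A_12. Hence it suffices that phi is additive on elements of
   this form. For u, v in A_12,
     T_{e_2} [e_1 + u, e_2 + v] = (u - u^* ) + (v - v^* ),
   and additivity at (e_1, u) and (e_2, v) follows from similar detecting maps,
   chosen so that each kills one of the two summands. Finally,
   p_{n*}(a, 1, ..., 1) = 2^(n-2) (a - a^* ) gives phi (a^* ) = (phi a)^*. *)
Require Import Defs.
From HB Require Import structures.
From mathcomp Require Import all_boot all_order all_algebra.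
From mathcomp Require Import reals complex.

Set Implicit Arguments.
Unset Strict Implicit.
Unset Printing Implicit Defensive.

Import GRing.Theory Num.Theory.
Local Open Scope ring_scope.

(** * Zero and sign rules for a bilinear product *)

Section NonassocTheory.
Variables (K : pzRingType) (A : naAlgType K).
Implicit Types x y z : A.

Lemma namul0l x : 0 ** x = 0.
Proof. by apply: (addrI (0 ** x)); rewrite -namulDl !addr0. Qed.

Lemma namul0r x : x ** 0 = 0.
Proof. by apply: (addrI (x ** 0)); rewrite -namulDr !addr0. Qed.

Lemma namulNl x y : (- x) ** y = - (x ** y).
Proof. by apply: (addrI (x ** y)); rewrite -namulDl !subrr namul0l. Qed.

Lemma namulNr x y : x ** (- y) = - (x ** y).
Proof. by apply: (addrI (x ** y)); rewrite -namulDr !subrr namul0r. Qed.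

Lemma namulBl x y z : (x - y) ** z = x ** z - y ** z.
Proof. by rewrite namulDl namulNl. Qed.

Lemma namulBr x y z : x ** (y - z) = x ** y - x ** z.
Proof. by rewrite namulDr namulNr. Qed.

End NonassocTheory.

(** * Additivity of the involution and of the brackets built from it *)

Section StarTheory.
Variables (K : pzRingType) (A : starAlgType K).
Implicit Types x y z a b : A.

Lemma star0 : star 0 = 0 :> A.
Proof. by apply: (addrI (star 0)); rewrite -starD !addr0. Qed.

Lemma starN x : star (- x) = - star x.
Proof. by apply: (addrI (star x)); rewrite -starD !subrr star0. Qed.

Lemma starB x y : star (x - y) = star x - star y.
Proof. by rewrite starD starN. Qed.

Lemma star1 : star naone = naone :> A.
Proof. by rewrite -[LHS]namul1l -{1}[naone]starK -starM namul1l starK. Qed.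

Lemma lie_star0 x : lie_star x 0 = 0.
Proof. by rewrite /lie_star namul0l namul0r subrr. Qed.

Lemma lie_starDl x y z : lie_star (x + y) z = lie_star x z + lie_star y z.
Proof. by rewrite /lie_star starD namulDl namulDr opprD addrACA. Qed.

Lemma lie_starDr x y z : lie_star x (y + z) = lie_star x y + lie_star x z.
Proof. by rewrite /lie_star namulDl namulDr opprD addrACA. Qed.

Lemma lie_starBr x y z : lie_star x (y - z) = lie_star x y - lie_star x z.
Proof.
by apply: (addIr (lie_star x z)); rewrite -lie_starDr !subrK.
Qed.

Lemma pstarD x y s : pstar (x + y) s = pstar x s + pstar y s.
Proof. by rewrite /pstar; elim: s x y => //= z s IH x y;
  rewrite lie_starDl IH. Qed.

Lemma pstar0 s : pstar (0 : A) s = 0.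
Proof. by apply: (addrI (pstar 0 s)); rewrite -pstarD !addr0. Qed.

Lemma pstarB x y s : pstar (x - y) s = pstar x s - pstar y s.
Proof. by apply: (addIr (pstar y s)); rewrite -pstarD !subrK. Qed.

(** The first bracket with 1 gives the skew element a - a^*, and bracketing a skew element with 1
    doubles it. *)
Lemma pstar_one a m :
  pstar a (nseq m.+1 naone) = (a - star a) *+ 2 ^ m.
Proof.
rewrite /pstar; elim: m a => [|m IH] a.
  by rewrite /= /lie_star namul1l namul1r.
rewrite [LHS]IH /lie_star namul1l namul1r starB starK.
by rewrite -[X in _ - X]opprB opprK -mulr2n -mulrnA -expnS.
Qed.

End StarTheory.

(** * Peirce decomposition of an alternative algebra *)

Section Peirce.
Variables (K : numFieldType) (A : naAlgType K).
Hypothesis altA : alternative A.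
Implicit Types x y z a b : A.

(** Linearization of the left alternative law at x + y: the associator is skew in its first two
    arguments. *)
Lemma alt_skew_l x y z : (x ** y) ** z - x ** (y ** z) =
  y ** (x ** z) - (y ** x) ** z.
Proof.
have [+ _] := altA (x + y) z.
rewrite !namulDl !namulDr !namulDl (altA x z).1 (altA y z).1.
rewrite -!addrA => /addrI; rewrite !addrA => /addIr.
move=> H; apply/eqP; rewrite subr_eq addrAC eq_sym subr_eq eq_sym.
by rewrite H addrC.
Qed.

Lemma alt_skew_r x y z : (z ** x) ** y - z ** (x ** y) =
  z ** (y ** x) - (z ** y) ** x.
Proof.
have [_ +] := altA (x + y) z.
rewrite !namulDr !namulDl !namulDr (altA x z).2 (altA y z).2.
rewrite -!addrA => /addrI; rewrite !addrA => /addIr.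
move=> H; apply/eqP; rewrite subr_eq addrAC eq_sym subr_eq.
by rewrite H addrC.
Qed.

Lemma alt_flexible x y : (x ** y) ** x = x ** (y ** x).
Proof. by apply/eqP; rewrite -subr_eq0 alt_skew_l (altA x y).2 subrr. Qed.

(** Skewness of the associator, solved for the product by [e], so that the action of [e] on x y is
    read off from its actions on x and y. *)
Lemma alt_mul_l e x y : e ** (x ** y) =
  (e ** x) ** y + (x ** e) ** y - x ** (e ** y).
Proof. by rewrite -addrA -[X in _ + X]opprB -alt_skew_l opprB addrC subrK. Qed.

Lemma alt_mul_r e x y : (x ** y) ** e =
  x ** (y ** e) + x ** (e ** y) - (x ** e) ** y.
Proof. by rewrite -addrA -alt_skew_r addrC subrK. Qed.

Lemma addrr_eq0 x : x + x = 0 -> x = 0.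
Proof.
move=> /eqP; rewrite -mulr2n -scaler_nat scaler_eq0 pnatr_eq0 /=.
by move/eqP.
Qed.

Variable e : A.
Hypothesis e_idem : idempotent_elt e.

Lemma idem_mulK x : e ** (e ** x) = e ** x.
Proof. by rewrite -(altA e x).1 e_idem. Qed.

Lemma idem_mulKr x : (x ** e) ** e = x ** e.
Proof. by rewrite -(altA e x).2 e_idem. Qed.

Lemma idem_compl : idempotent_elt (naone - e).
Proof.
by rewrite /idempotent_elt namulBl !namulBr !namul1l namul1r e_idem subrr subr0.
Qed.

(* The booleans [true] and [false] stand for the Peirce indices 1 and 2. *)
Definition peirce (i j : bool) x :=
  e ** x = (if i then x else 0) /\ x ** e = (if j then x else 0).

Lemma peirceD i j x y : peirce i j x -> peirce i j y -> peirce i j (x + y).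
Proof.
by case: i j => [] [] [xl xr] [yl yr]; split;
  rewrite ?namulDl ?namulDr ?xl ?xr ?yl ?yr ?addr0.
Qed.

Lemma peirceN i j x : peirce i j x -> peirce i j (- x).
Proof.
by case: i j => [] [] [xl xr]; split; rewrite ?namulNl ?namulNr ?xl ?xr ?oppr0.
Qed.

Lemma peirceM i j k x y : peirce i j x -> peirce j k y -> peirce i k (x ** y).
Proof.
case: i j k => [] [] [] [xl xr] [yl yr]; split;
  rewrite ?(alt_mul_l e x y) ?(alt_mul_r e x y) ?xl ?xr ?yl ?yr;
  by rewrite ?namul0l ?namul0r ?subr0 ?add0r ?addr0 ?addrK ?subrr.
Qed.

(** This is where alternative algebras differ from associative ones, in which A_12 A_12 = 0. *)
Lemma peirceM_off i x y :
  peirce i (~~ i) x -> peirce i (~~ i) y -> peirce (~~ i) i (x ** y).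
Proof.
case: i => [] [xl xr] [yl yr]; split;
  rewrite ?(alt_mul_l e x y) ?(alt_mul_r e x y) ?xl ?xr ?yl ?yr;
  by rewrite ?namul0l ?namul0r ?subr0 ?add0r ?addr0 ?addrK ?subrr.
Qed.

(* The products not covered by the two previous rules are eigenvectors of a
   multiplication by [e] for the eigenvalue 2 or -1; being a projection, that
   multiplication has no such eigenvalue. *)
Lemma peirceM0 i j k l x y :
  peirce i j x -> peirce k l y -> j != k -> (i, j) != (k, l) -> x ** y = 0.
Proof.
have proj2 (p : A -> A) z : (forall t, p (p t) = p t) ->
  {morph p : s t / s + t} ->
    p z = z + z \/ p z = - z -> z = 0.
  move=> pK pD [] pz; apply: addrr_eq0.
    by have := pK z; rewrite !pz pD !pz => /(canRL (addrK _)); rewrite subrr.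
  have p0 : p 0 = 0 by apply: (addrI (p 0)); rewrite -pD !addr0.
  have: p (z + p z) = 0 by rewrite pz subrr.
  by rewrite pD pK pz -opprD => /eqP; rewrite oppr_eq0 => /eqP.
have projl := @proj2 (fun t => e ** t) _ idem_mulK (fun _ _ => namulDr _ _ _).
have projr := @proj2 (fun t => t ** e) _ idem_mulKr (fun _ _ => namulDl _ _ _).
move=> [xl xr] [yl yr] jk ij_kl.
have Hl := alt_mul_l e x y; have Hr := alt_mul_r e x y.
move: Hl Hr; rewrite xl xr yl yr.
case: i j k l jk ij_kl {xl xr yl yr} => [] [] [] [] // _ _;
  rewrite ?namul0l ?namul0r ?add0r ?addr0 ?subr0 ?sub0r => Hl Hr;
  by [apply: projl; auto | apply: projr; auto].
Qed.

Definition peirce_elt (b : bool) := if b then e else naone - e.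

Definition peirce_comp i j x := peirce_elt i ** (x ** peirce_elt j).

Lemma peirce_compP i j x : peirce i j (peirce_comp i j x).
Proof.
have flex := alt_flexible e.
by rewrite /peirce_comp; case: i j => [] [] /=; split;
  rewrite ?(namulBr, namulBl, namul1l, namul1r) ?idem_mulK -?flex
    ?idem_mulKr ?flex ?idem_mulK ?subrr ?subr0.
Qed.

Lemma peirce_decomp x :
  x = peirce_comp true true x + peirce_comp true false x
      + peirce_comp false true x + peirce_comp false false x.
Proof.
rewrite /peirce_comp /= -addrA -!namulDr.
by rewrite -namulDl !(addrC e) subrK namul1l namul1r.
Qed.

End Peirce.

Lemma peirce_compl (K : numFieldType) (A : naAlgType K) (e : A) i j x :
  peirce e i j x -> peirce (naone - e) (~~ i) (~~ j) x.
Proof.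
by case: i j => [] [] [xl xr]; split;
  rewrite ?namulBl ?namulBr ?namul1l ?namul1r ?xl ?xr ?subrr ?subr0.
Qed.

(** * Detection of Peirce components by iterated brackets *)

Section StarPeirce.
Variables (K : numFieldType) (A : starAlgType K).
Hypothesis altA : alternative A.
Implicit Types (x y z a b d : A) (m : nat).

(* [plie m x xi y] is the paper's p_{n*}(x, y, xi, ..., xi) with n = m + 2. *)
Definition plie m x xi y : A := pstar (lie_star x y) (nseq m xi).

Lemma plieD m x xi y z : plie m x xi (y + z) = plie m x xi y + plie m x xi z.
Proof. by rewrite /plie lie_starDr pstarD. Qed.

Lemma plieB m x xi y z : plie m x xi (y - z) = plie m x xi y - plie m x xi z.
Proof. by rewrite /plie lie_starBr pstarB. Qed.

Lemma plie0 m x xi : plie m x xi 0 = 0.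
Proof. by rewrite /plie lie_star0 pstar0. Qed.

Variable e : A.
Hypotheses (e_idem : idempotent_elt e) (e_sym : symmetric_elt e).

Lemma sym_compl : symmetric_elt (naone - e).
Proof. by rewrite /symmetric_elt starB star1 e_sym. Qed.

Lemma peirce_star i j x : peirce e i j x -> peirce e j i (star x).
Proof.
move=> [xl xr]; split; rewrite -{1}e_sym -starM ?xl ?xr.
  by case: j {xr} => //; rewrite star0.
by case: i {xl} => //; rewrite star0.
Qed.

Lemma lie_star_sym y : lie_star y e = y ** e - star (y ** e).
Proof. by rewrite /lie_star starM e_sym. Qed.

(** Put u = y e. The first bracket yields u - u^*; as u^* e = (e u)^* = 0, each further bracket with
    [e] leaves it fixed. *)
Lemma pstar_corner m y :
  e ** (y ** e) = 0 -> pstar y (nseq m.+1 e) = y ** e - star (y ** e).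
Proof.
move=> ye; rewrite /pstar /= lie_star_sym; elim: m => //= m.
have yse : star (y ** e) ** e = 0 by rewrite -{2}e_sym -starM ye star0.
by rewrite lie_star_sym namulBl idem_mulKr // yse subr0.
Qed.

Definition skew_off t := exists2 u, peirce e true false u & t = u - star u.

(** The elements u and u^* lie in opposite off-diagonal Peirce spaces, which meet only in 0. *)
Lemma skew_off_inj i u : peirce e i (~~ i) u -> u - star u = 0 -> u = 0.
Proof.
move=> Pu; have [_] := peirce_star Pu; case: Pu => _.
case: i => /= ul ul' /eqP; rewrite subr_eq0 => /eqP E.
  by rewrite E -ul' -E.
by rewrite -ul E.
Qed.

Lemma skew_off_star u : peirce e false true u -> skew_off (u - star u).
Proof.
move=> Pu; exists (- star u); first exact/peirceN/peirce_star.
by rewrite starN starK opprK addrC.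
Qed.

Lemma plie_self_corner m d :
  plie m.+1 e e d =
  - (peirce_comp e false true d - star (peirce_comp e false true d)).
Proof.
set u := peirce_comp e false true d.
have ye : lie_star e d ** e = - u.
  rewrite /lie_star e_sym namulBl alt_flexible // idem_mulKr //.
  by rewrite /u /peirce_comp /= namulBl namul1l opprB.
rewrite /plie pstar_corner ye; first by rewrite starN opprD.
by rewrite namulNr (peirce_compP altA e_idem false true d).1 oppr0.
Qed.

Lemma plie_corner0 m x d : lie_star x d ** e = 0 -> plie m.+1 x e d = 0.
Proof.
by move=> y0; rewrite /plie pstar_corner y0 ?namul0r // star0 subrr.
Qed.

(** By the Peirce rules these are the only parts of x d and d x^* that end in index 1; the second
    one, in A_12 A_12, is specific to the nonassociative case. *)
Lemma lie_off_corner x d : peirce e false true x ->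
  lie_star x d ** e =
  x ** peirce_comp e true true d - peirce_comp e true false d ** star x.
Proof.
move=> Px; have Pz := peirce_star Px.
have Pd i j := peirce_compP altA e_idem i j d.
rewrite /lie_star {1 2}[d](peirce_decomp e) !namulDl !namulDr.
rewrite [x ** peirce_comp _ false false _](peirceM0 altA e_idem Px (Pd _ _)) //.
rewrite [peirce_comp _ false false _ ** _](peirceM0 altA e_idem (Pd _ _) Pz) //.
rewrite !addr0 namulNl !namulDl.
have [_ ->] := peirceM altA Px (Pd true true).
have [_ ->] := peirceM altA Px (Pd true false).
have [_ ->] := peirceM_off altA Px (Pd false true).
have [_ ->] := peirceM altA (Pd true true) Pz.
have [_ ->] := peirceM_off altA (Pd true false) Pz.
have [_ ->] := peirceM altA (Pd false true) Pz.
by rewrite !addr0 add0r.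
Qed.

Lemma plie_off_corner m x d : peirce e false true x ->
  let u := lie_star x d ** e in
  peirce e false true u /\ plie m.+1 x e d = u - star u.
Proof.
move=> Px u; have Pz := peirce_star Px.
have Pd i j := peirce_compP altA e_idem i j d.
have Pu : peirce e false true u.
  rewrite /u lie_off_corner //; apply: peirceD.
    exact: peirceM (Pd _ _).
  exact/peirceN/(peirceM_off altA (Pd _ _) Pz).
by split=> //; rewrite /plie pstar_corner // -/u Pu.1.
Qed.

(** The space A_11 is stable under the involution and under right multiplication by [e], so the
    brackets never leave it. *)
Lemma pstar_diag m y :
  peirce e true true (y ** e) -> peirce e true true (pstar y (nseq m.+1 e)).
Proof.
have diag_sub u : peirce e true true u -> peirce e true true (u - star u).
  by move=> Pu; apply/peirceD/peirceN/peirce_star.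
rewrite /pstar /=; elim: m y => [|m IH] y Py /=.
  by rewrite lie_star_sym; apply: diag_sub.
by apply: IH; rewrite lie_star_sym; have [_ ->] := diag_sub _ Py;
  apply: diag_sub.
Qed.

Definition faithful (e0 : A) :=
  forall x, (forall a, (e0 ** a) ** x = 0) -> x = 0.

Lemma plie_self_eq0 m d : plie m.+1 e e d = 0 -> peirce_comp e false true d = 0.
Proof.
rewrite plie_self_corner => /eqP; rewrite oppr_eq0 => /eqP.
exact/(@skew_off_inj false)/peirce_compP.
Qed.

(** With f = 1 - e, split f a = f a e + f a f; since A_22 A_11 = 0, only the summand in A_21 acts on
    [d]. *)
Lemma faithful_diag d : faithful (naone - e) -> peirce e true true d ->
  (forall x, peirce e false true x -> x ** d = 0) -> d = 0.
Proof.
move=> faith Pd xd; apply: faith => a.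
have Pa i := peirce_compP altA e_idem false i a.
rewrite (_ : (naone - e) ** a =
    peirce_comp e false true a + peirce_comp e false false a).
  by rewrite namulDl xd // add0r (peirceM0 altA e_idem (Pa false) Pd).
by rewrite /peirce_comp /= -!namulDr (addrC e) subrK namul1r.
Qed.

Lemma plie_off_eq0 m d : faithful (naone - e) ->
  peirce_comp e true false d = 0 ->
    (forall x, peirce e false true x -> plie m.+1 x e d = 0) ->
  peirce_comp e true true d = 0.
Proof.
move=> faith d10 opd; apply: faithful_diag => // [|x Px].
  exact: peirce_compP.
have [Pu E] := plie_off_corner m d Px; move: E; rewrite opd // => /esym.
by move/(skew_off_inj Pu); rewrite lie_off_corner // d10 namul0l subr0.
Qed.

(** Here x b lies in A_21 and b x^* in A_11, and both end in index 1. *)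
Lemma lie_off_off_corner x b : peirce e true false x -> peirce e true false b ->
  lie_star x b ** (naone - e) = 0.
Proof.
move=> Px Pb; have Pz := peirce_star Px.
have [_ xbr] := peirceM_off altA Px Pb; have [_ bzr] := peirceM altA Pb Pz.
by rewrite namulBr namul1r /lie_star namulBl xbr bzr subrr.
Qed.

End StarPeirce.

(** * Exchange of the two idempotents *)

Section Complement.
Variables (K : numFieldType) (A : starAlgType K).
Hypothesis altA : alternative A.
Implicit Types (x y z a b d : A) (m : nat).
Variable e : A.
Hypotheses (e_idem : idempotent_elt e) (e_sym : symmetric_elt e).
Let f := naone - e.
Let f_idem : idempotent_elt f := idem_compl e_idem.
Let f_sym : symmetric_elt f := sym_compl e_sym.

Lemma complK : naone - f = e.
Proof. by rewrite /f subKr. Qed.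

Lemma peirce_comp_compl i j x :
  peirce_comp f i j x = peirce_comp e (~~ i) (~~ j) x.
Proof. by rewrite /peirce_comp; case: i j => [] []; rewrite /= ?complK. Qed.

(** The exchange turns A_12 into A_21, and u - u^* is unchanged when u is replaced by -u^*. *)
Lemma skew_off_compl t : skew_off f t -> skew_off e t.
Proof.
by case=> u /peirce_compl; rewrite complK => Pu ->; apply: skew_off_star.
Qed.

(** A composite test for d_11, for use where T_e [x, -] kills neither summand: T_f [x, -] produces
    d_11 x^*, up to sign and involution, and T_f [f, -] then discards everything in A_22. *)
Lemma off_plie_eq0 m d : faithful f ->
    peirce_comp e true false d = 0 -> peirce_comp e false true d = 0 ->
    (forall x, peirce e false true x -> plie m.+1 f f (plie m.+1 x f d) = 0) ->
  peirce_comp e true true d = 0.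
Proof.
move=> faith d10 d01 opd.
have Pd i j := peirce_compP altA e_idem i j d.
(* Faithfulness concerns left multiplication, whereas d_11 stands to the left of x^*; the involution
   turns d_11 x^* into x d_11^*. *)
have d11s0 : star (peirce_comp e true true d) = 0.
  apply: (faithful_diag altA e_idem) => // [|x Px]; first exact: peirce_star.
  have Pz := peirce_star e_sym Px.
  set v := peirce_comp e true true d ** star x.
  have Pv : peirce e true false v := peirceM altA (Pd _ _) Pz.
  have yf : lie_star x d ** f = - v.
    rewrite /lie_star [d](peirce_decomp e) d10 d01 !addr0.
    rewrite (namulDr x) (namulDl _ _ (star x)).
    rewrite (peirceM0 altA e_idem Px (Pd false false)) //.
    rewrite (peirceM0 altA e_idem (Pd false false) Pz) // !addr0 -/v.
    have [_ r] := peirceM altA Px (Pd true true).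
    by rewrite /f namulBl !namulBr !namul1r r Pv.2 subr0 subrr sub0r.
  have w : plie m.+1 x f d = star v - v.
    rewrite /plie pstar_corner // yf ?starN ?opprK 1?addrC //.
    by rewrite namulNr /f namulBl namul1l Pv.1 subrr oppr0.
  have := plie_self_eq0 altA f_idem f_sym (opd _ Px).
  have [/= Pvl Pvr] := Pv; have [/= Psl Psr] := peirce_star e_sym Pv.
  rewrite w peirce_comp_compl /peirce_comp /= namulBl !namulBr !namul1r Pvr Psr.
  rewrite subrr sub0r namul0r subr0 Pvl => /eqP; rewrite oppr_eq0 => /eqP v0.
  by rewrite -[x]starK -starM -/v v0 star0.
by rewrite -[LHS]starK d11s0 star0.
Qed.

End Complement.

(** * Bijections preserving the brackets, and their additivity at a pair *)

Section Preserver.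
Variables (K : numFieldType) (A A' : starAlgType K).
Variables (phi : A -> A') (m : nat).
Hypothesis phi_bij : bijective phi.
Implicit Types a b c d x xi : A.

Definition preserves_plie k xi :=
  forall a b, phi (plie k a xi b) = plie k (phi a) (phi xi) (phi b).

(** Needed for n = 2: [pstar_corner] and the detecting maps require at least one trailing [xi]. *)
Lemma preserves_plie1 xi : preserves_plie 0 xi -> preserves_plie 1 xi.
Proof.
move=> p0 a b.
transitivity (plie 0 (phi (plie 0 a xi b)) (phi xi) (phi xi)); first exact: p0.
by rewrite p0.
Qed.

Definition additive_at a b := phi (a + b) = phi a + phi b.

(** Surjectivity supplies b with phi b = 0; the bracket of 0 and b is 0, and so is that of their
    images. *)
Lemma phi0 xi : preserves_plie m xi -> phi 0 = 0.
Proof.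
case: phi_bij => psi _ psiK phi_op.
have := phi_op 0 (psi 0); rewrite psiK plie0 => <-.
by rewrite /plie /lie_star star0 namul0l namul0r subrr pstar0.
Qed.

Lemma additive_at0l a b xi : preserves_plie m xi -> a = 0 -> additive_at a b.
Proof. by move=> phi_op ->; rewrite /additive_at (phi0 phi_op) !add0r. Qed.

Lemma additive_at0r a b xi : preserves_plie m xi -> b = 0 -> additive_at a b.
Proof. by move=> phi_op ->; rewrite /additive_at (phi0 phi_op) !addr0. Qed.

Definition splits c a b := phi c = phi a + phi b.

(** Surjectivity provides the c with phi c = phi a + phi b, which must then be a + b. *)
Lemma additive_atP a b :
  (forall c, splits c a b -> c - (a + b) = 0) -> additive_at a b.
Proof.
case: phi_bij => psi _ psiK split0; rewrite /additive_at.
have := split0 (psi (phi a + phi b)); rewrite /splits psiK => /(_ erefl) /eqP.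
by rewrite subr_eq0 => /eqP <-; rewrite psiK.
Qed.

Lemma plie_splits c a b x xi : preserves_plie m xi -> splits c a b ->
  splits (plie m x xi c) (plie m x xi a) (plie m x xi b).
Proof. by move=> phi_op cab; rewrite /splits !phi_op cab plieD. Qed.

Lemma plie_splits_eq0 c a b x xi : preserves_plie m xi -> splits c a b ->
  additive_at (plie m x xi a) (plie m x xi b) -> plie m x xi (c - (a + b)) = 0.
Proof.
move=> phi_op cab; have := plie_splits x phi_op cab;
  rewrite /splits /additive_at => <-.
by move/(bij_inj phi_bij) => E; rewrite plieB plieD E subrr.
Qed.

End Preserver.

(** * Additivity, first at special pairs and then everywhere *)

Section Additivity.
Variables (K : numFieldType) (A A' : starAlgType K).
Hypothesis altA : alternative A.
Variables (phi : A -> A') (m : nat).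
Hypothesis phi_bij : bijective phi.
Implicit Types a b c d x xi : A.
Variable e : A.
Hypotheses (e_idem : idempotent_elt e) (e_sym : symmetric_elt e).
Let f := naone - e.
Let f_idem : idempotent_elt f := idem_compl e_idem.
Let f_sym : symmetric_elt f := sym_compl e_sym.
Hypotheses (faith_e : faithful e) (faith_f : faithful f).
Hypotheses (phi_e : preserves_plie phi m.+1 e)
  (phi_f : preserves_plie phi m.+1 f).

Let ef0 : e ** f = 0. Proof. by rewrite namulBr namul1r e_idem subrr. Qed.
Let fe0 : f ** e = 0. Proof. by rewrite namulBl namul1l e_idem subrr. Qed.

Lemma peirce_comp_eq0 d :
    peirce_comp e true false d = 0 -> peirce_comp e false true d = 0 ->
    peirce_comp e true true d = 0 -> peirce_comp e false false d = 0 ->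
  d = 0.
Proof.
by move=> d10 d01 d11 d00; rewrite [d](peirce_decomp e) d10 d01 d11 d00 !addr0.
Qed.

Let faith_ff : faithful (naone - f).
Proof. by rewrite complK. Qed.

Let off_compl i x : peirce f i (~~ i) x -> peirce e (~~ i) i x.
Proof. by move/peirce_compl; rewrite complK negbK. Qed.

Lemma additive_at_idem b : peirce e true false b -> additive_at phi e b.
Proof.
move=> Pb; apply: additive_atP => // c cab.
have d01 : peirce_comp e false true (c - (e + b)) = 0.
  apply: (plie_self_eq0 altA _ _ (m := m)) => //;
    apply: (plie_splits_eq0 phi_bij) => //.
  by apply: (additive_at0l phi_bij _ phi_e) => //;
    rewrite /plie /lie_star e_sym subrr pstar0.
have d10 : peirce_comp e true false (c - (e + b)) = 0.
  rewrite -[LHS](peirce_comp_compl e false true).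
  apply: (plie_self_eq0 altA _ _ (m := m)) => //;
    apply: (plie_splits_eq0 phi_bij) => //.
  apply: (additive_at0l phi_bij _ phi_e) => //.
  by rewrite /plie /lie_star f_sym ef0 fe0 subrr pstar0.
apply: peirce_comp_eq0 => //.
  apply: (off_plie_eq0 altA _ _ (m := m)) => // x Px.
  have Pz := peirce_star e_sym Px.
  rewrite (plieB _ x) (plieD _ x); apply: (plie_splits_eq0 phi_bij phi_f).
    exact: plie_splits.
  apply: (additive_at0r phi_bij _ phi_e) => //.
  suff [/= l r] : peirce f true true (plie m.+1 x f b).
    by rewrite {1}/plie /lie_star f_sym l r subrr pstar0.
  apply: pstar_diag => //.
  have Pxb := peirce_compl (peirceM altA Px Pb).
  have [_ bzr] := peirce_compl (peirceM_off altA Pb Pz).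
  by rewrite /lie_star namulBl bzr subr0 Pxb.2.
rewrite -[LHS](peirce_comp_compl e true true).
apply: (plie_off_eq0 altA _ _ (m := m)) => //.
  by rewrite peirce_comp_compl.
(* Now x is in A_12, so x e = e x^* = 0 and the summand [e] is killed. *)
move=> x /off_compl Px; apply: (plie_splits_eq0 phi_bij) => //.
apply: (additive_at0l phi_bij _ phi_e) => //.
by rewrite /plie /lie_star (peirce_star e_sym Px).1 Px.2 subrr pstar0.
Qed.

(** Not the previous lemma with [e] and [f] exchanged, since [b] stays in A_12. Single maps suffice:
    T_e [x, -] with x in A_21 kills [f], and T_f [x, -] with x in A_12 kills [b]. *)
Lemma additive_at_compl b : peirce e true false b -> additive_at phi f b.
Proof.
move=> Pb; apply: additive_atP => // c cab.
have d01 : peirce_comp e false true (c - (f + b)) = 0.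
  apply: (plie_self_eq0 altA _ _ (m := m)) => //;
    apply: (plie_splits_eq0 phi_bij) => //.
  apply: (additive_at0l phi_bij _ phi_e) => //.
  by rewrite /plie /lie_star e_sym ef0 fe0 subrr pstar0.
have d10 : peirce_comp e true false (c - (f + b)) = 0.
  rewrite -[LHS](peirce_comp_compl e false true).
  apply: (plie_self_eq0 altA _ _ (m := m)) => //;
    apply: (plie_splits_eq0 phi_bij) => //.
  by apply: (additive_at0l phi_bij _ phi_e) => //;
    rewrite /plie /lie_star f_sym subrr pstar0.
apply: peirce_comp_eq0 => //.
  apply: (plie_off_eq0 altA _ _ (m := m)) => // x Px.
  apply: (plie_splits_eq0 phi_bij) => //;
    apply: (additive_at0l phi_bij _ phi_e) => //.
  have [_ xf] := peirce_compl Px;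
    have [fz _] := peirce_compl (peirce_star e_sym Px).
  by rewrite /plie /lie_star xf fz subrr pstar0.
rewrite -[LHS](peirce_comp_compl e true true).
apply: (plie_off_eq0 altA _ _ (m := m)) => //.
  by rewrite peirce_comp_compl.
move=> x /off_compl Px; apply: (plie_splits_eq0 phi_bij) => //.
apply: (additive_at0r phi_bij _ phi_e) => //.
by apply: plie_corner0 => //; apply: lie_off_off_corner.
Qed.

Lemma additive_at_skew s t : skew_off e s -> skew_off e t ->
  additive_at phi s t.
Proof.
case=> u Pu -> [v Pv ->].
have [/= fu uf] := peirce_compl Pu; have [/= fv vf] := peirce_compl Pv.
have [/= _ usf] := peirce_compl (peirce_star e_sym Pu).
have opeff : plie m.+1 e f f = 0.
  by rewrite /plie /lie_star e_sym ef0 fe0 subrr pstar0.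
have opefv : plie m.+1 e f v = v - star v.
  have le : lie_star e v = v by rewrite /lie_star e_sym Pv.1 Pv.2 subr0.
  by rewrite /plie le pstar_corner // vf.
have opuff : plie m.+1 u f f = u - star u.
  have lf : lie_star u f ** f = u
    by rewrite lie_star_sym // uf namulBl uf usf subr0.
  by rewrite /plie pstar_corner // lf.
have opufv : plie m.+1 u f v = 0.
  by apply: plie_corner0 => //; apply: lie_off_off_corner.
have opDl (B : starAlgType K) (x y xi b : B) k :
    plie k (x + y) xi b = plie k x xi b + plie k y xi b.
  by rewrite /plie lie_starDl pstarD.
have := phi_f (e + u) (f + v).
(* Both sides expand into four brackets, those on the right being pulled back through [phi]; the
   pairs (e, f) and (u, v) contribute 0. *)
rewrite additive_at_idem // additive_at_compl // !opDl !(plieD _ _ _ f v)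
  !(plieD _ _ _ (phi f)) -!phi_f.
rewrite opeff opefv opuff opufv (phi0 phi_bij phi_f) !add0r !addr0.
by rewrite /additive_at [in LHS]addrC => ->; rewrite addrC.
Qed.

Lemma preserver_additive a b : additive_at phi a b.
Proof.
(* For both idempotents, every value of a detecting map is of the form u - u^*, where additivity is
   known, so [a] and [b] can be arbitrary. *)
have skew_self g x : idempotent_elt g -> symmetric_elt g ->
  skew_off g (plie m.+1 g g x).
  move=> gi gs; rewrite plie_self_corner // opprD -starN.
  exact/skew_off_star/peirceN/peirce_compP.
have skew_plie g x y : idempotent_elt g -> symmetric_elt g ->
    peirce g false true x -> skew_off g (plie m.+1 x g y).
  move=> gi gs Px; have [Pu ->] := plie_off_corner altA gi gs m y Px.
  exact: skew_off_star.
apply: additive_atP => // c cab.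
have d01 : peirce_comp e false true (c - (a + b)) = 0.
  apply: (plie_self_eq0 altA _ _ (m := m)) => //;
    apply: (plie_splits_eq0 phi_bij) => //.
  by apply: additive_at_skew; apply: skew_self.
have d10 : peirce_comp e true false (c - (a + b)) = 0.
  rewrite -[LHS](peirce_comp_compl e false true).
  apply: (plie_self_eq0 altA _ _ (m := m)) => //;
    apply: (plie_splits_eq0 phi_bij) => //.
  by apply: additive_at_skew; apply: skew_off_compl => //; apply: skew_self.
apply: peirce_comp_eq0 => //.
  apply: (plie_off_eq0 altA _ _ (m := m)) => // x Px.
  by apply: (plie_splits_eq0 phi_bij) => //; apply: additive_at_skew;
    apply: skew_plie.
rewrite -[LHS](peirce_comp_compl e true true).
apply: (plie_off_eq0 altA _ _ (m := m)) => //.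
  by rewrite peirce_comp_compl.
move=> x Px; apply: (plie_splits_eq0 phi_bij) => //.
by apply: additive_at_skew; apply: skew_off_compl => //; apply: skew_plie.
Qed.

End Additivity.

(** * Brackets with the identity and compatibility with the involution *)

Lemma plie_one (K : numFieldType) (A : starAlgType K) m (a : A) :
  plie m a naone naone = (a - star a) *+ 2 ^ m.
Proof. exact: (pstar_one a m). Qed.

Lemma mulrn_pow2_inj (K : numFieldType) (A : lmodType K) k (x y : A) :
  x *+ 2 ^ k = y *+ 2 ^ k -> x = y.
Proof.
have two_inj (u v : A) : u *+ 2 = v *+ 2 -> u = v.
  rewrite -!scaler_nat; apply: scalerI.
  by rewrite pnatr_eq0.
elim: k => [|k IH] //; rewrite expnSr !mulrnA => /two_inj; exact: IH.
Qed.

Theorem theorem2p1 (R : realType) (A A' : starAlgType R[i])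
  (altA : alternative A) (altA' : alternative A')
  (e1 e2 : A) (e2E : e2 = naone - e1)
  (e1_idem : idempotent_elt e1) (e1_nontriv : nontrivial_elt e1)
  (e1_sym : symmetric_elt e1)
  (e2_idem : idempotent_elt e2) (e2_nontriv : nontrivial_elt e2)
  (e2_sym : symmetric_elt e2)
  (faithful1 : forall x : A, (forall a : A, (e1 ** a) ** x = 0) -> x = 0)
  (faithful2 : forall x : A, (forall a : A, (e2 ** a) ** x = 0) -> x = 0)
  (n : nat) (n_ge2 : (2 <= n)%N)
  (phi : A -> A') (phi_bij : bijective phi) (phi_unital : phi naone = naone)
  (phi_pstar : forall a b xi : A, xi = e1 \/ xi = e2 \/ xi = naone ->
     phi (pstar a (b :: nseq (n - 2) xi)) =
     pstar (phi a) (phi b :: nseq (n - 2) (phi xi))) :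
  (forall a b : A, phi (a + b) = phi a + phi b) /\
  (forall a : A, phi (star a) = star (phi a)).
Proof.
have [m pres] : exists m, forall xi, xi = e1 \/ xi = e2 \/ xi = naone ->
    preserves_plie phi m.+1 xi.
  case: (n - 2)%N phi_pstar => [|m] phi_op.
    by exists 0%N => xi Hxi; apply: preserves_plie1 => a b; apply: phi_op Hxi.
  by exists m => xi Hxi a b; apply: phi_op Hxi.
have pres1 : preserves_plie phi m.+1 naone by apply: pres; auto.
have phiD : forall a b, phi (a + b) = phi a + phi b.
  subst e2.
  exact: (preserver_additive altA phi_bij e1_idem e1_sym faithful1 faithful2
    (pres _ (or_introl erefl)) (pres _ (or_intror (or_introl erefl)))).
have phi_0 := phi0 phi_bij pres1.
have phiB a b : phi (a - b) = phi a - phi b.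
  by apply: (addIr (phi b)); rewrite -phiD !subrK.
have phiMn a k : phi (a *+ k) = phi a *+ k.
  by elim: k => [|k IH]; rewrite ?mulr0n // !mulrS phiD IH.
split=> // a.
(* Both sides carry the same power of 2, which is cancelled by invertibility in the scalar field. *)
have := pres1 a naone; rewrite phi_unital !plie_one phiMn phiB.
by move/mulrn_pow2_inj/addrI/oppr_inj.
Qed.
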